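(* Let $f:\mathbb{R}^{m\times n}\to\mathbb{R}$ be $L$-smooth, i.e. $f({\bm X})\le f({\bm Y})+\langle\nabla f({\bm Y}),{\bm X}-{\bm Y}\rangle+\frac L2\|{\bm X}-{\bm Y}\|_F^2$ for all ${\bm X},{\bm Y}$, and let $f_*:=\inf_{{\bm X}}f({\bm X})>-\infty$. Let $d=\min\{m,n\}$, $\alpha\in(1,2]$, $\sigma>0$, and consider the iteration ${\bm X}_{k+1}={\bm X}_k-\eta\,\mathcal{C}_\tau({\bm G}_k)$, $k=0,1,\dots$, where $\mathbb{E}[{\bm G}_k\mid{\bm X}_k]=\nabla f({\bm X}_k)$ and $\mathbb{E}[\|{\bm G}_k-\nabla f({\bm X}_k)\|_F^\alpha\mid{\bm X}_k]\le\sigma^\alpha$. Suppose the constant step size satisfies $\eta\le\frac{1}{4dL}$ and the threshold satisfies $\tau\ge\max\{2,8\sigma\}$. Then for every $K\ge1$, $$\min_{0\le k\le K-1}\mathbb{E}\big[\phi(\|\nabla f({\bm X}_k)\|_F)\big]\le\frac{4(f({\bm X}_0)-f_* )}{\eta K}+32\,\tau^{-2(\alpha-1)}\sigma^{2\alpha}+8\eta dL\,\tau^{2-\alpha}\sigma^\alpha,$$ where $\phi(t):=\min\{t,t^2\}$.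
   Context: $\|\cdot\|_F$ is the Frobenius norm and $\langle\cdot,\cdot\rangle$ the Frobenius inner product. Spectral clipping: for ${\bm G}\in\mathbb{R}^{m\times n}$ with (thin) SVD ${\bm G}={\bm U}\,\mathrm{diag}(\sigma_1,\dots,\sigma_d){\bm V}^\top$, $d=\min\{m,n\}$, and threshold $\tau>0$, define $\mathcal{C}_\tau({\bm G}):={\bm U}\,\mathrm{diag}(\min\{\sigma_1,\tau\},\dots,\min\{\sigma_d,\tau\}){\bm V}^\top$. *)

(* Defs.v *)
From HB Require Import structures.
From mathcomp Require Import all_boot all_order all_algebra.
From mathcomp Require Import all_classical all_reals all_analysis.
Set Implicit Arguments. Unset Strict Implicit. Unset Printing Implicit Defensive.
Import Order.TTheory GRing.Theory Num.Theory.
Local Open Scope classical_set_scope.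
Local Open Scope ring_scope.

Definition frob_inner (R : realType) (m n : nat) (A B : 'M[R]_(m, n)) : R :=
  \sum_(i < m) \sum_(j < n) A i j * B i j.

Definition frob_norm (R : realType) (m n : nat) (A : 'M[R]_(m, n)) : R :=
  Num.sqrt (frob_inner A A).

Definition is_gradient (R : realType) (m n : nat)
    (f : 'M[R]_(m, n) -> R) (g : 'M[R]_(m, n) -> 'M[R]_(m, n)) : Prop :=
  forall X : 'M[R]_(m, n), forall eps : R, 0 < eps ->
    exists2 delta : R, 0 < delta &
      forall H : 'M[R]_(m, n), frob_norm H < delta ->
        `| f (X + H) - f X - frob_inner (g X) H | <= eps * frob_norm H.

Definition L_smooth (R : realType) (m n : nat) (L : R)
    (f : 'M[R]_(m, n) -> R) (g : 'M[R]_(m, n) -> 'M[R]_(m, n)) : Prop :=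
  forall X Y : 'M[R]_(m, n),
    f X <= f Y + frob_inner (g Y) (X - Y) + L / 2 * frob_norm (X - Y) ^+ 2.

Definition is_thin_svd (R : realType) (m n : nat) (G : 'M[R]_(m, n))
    (U : 'M[R]_(m, minn m n)) (s : 'rV[R]_(minn m n))
    (V : 'M[R]_(n, minn m n)) : Prop :=
  [/\ U^T *m U = 1%:M, V^T *m V = 1%:M, (forall i, 0 <= s 0 i)
    & G = U *m diag_mx s *m V^T].

(* C is the spectral clipping C_tau(G): obtained from a thin SVD of G by
   replacing each singular value s_i by min(s_i, tau).  (The result does not
   depend on the chosen SVD.) *)
Definition spectral_clip (R : realType) (m n : nat) (tau : R)
    (G C : 'M[R]_(m, n)) : Prop :=
  exists U s V, is_thin_svd G U s V /\
    C = U *m diag_mx (\row_i Num.min (s 0 i) tau) *m V^T.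

Definition gen_events (d : measure_display) (T : measurableType d)
    (R : realType) (m n : nat) (X : T -> 'M[R]_(m, n)) : set (set T) :=
  [set A | exists i j (B : set R), measurable B /\
                                   A = (fun w => X w i j) @^-1` B].

Definition sigma_rv (d : measure_display) (T : measurableType d)
    (R : realType) (m n : nat) (X : T -> 'M[R]_(m, n)) : set (set T) :=
  <<s gen_events X >>.

Definition phi (R : realType) (t : R) : R := Num.min t (t ^+ 2).

(* Main.v *)
(* Write A for the gradient at X_k, N for the noise G_k - A, C for the clipped
   G_k, and a, z, g for the Frobenius norms of A, N, G_k. No singular value of
   G_k exceeds g, so clipping moves G_k by at most max(g - tau, 0). If
   a <= tau / 2, clipping acts only when z >= tau / 2; hence
   <A, C> >= a^2 + <A, N> - 2 a tau^(1 - alpha) z^alpha, and <A, N> has zero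
   conditional mean. If a > tau / 2, then <A, C> >= tau a / 2 - 2 a z, and the
   loss is absorbed because the conditional mean of z is at most
   sigma <= tau / 8. The second-order term costs a multiple of
   d tau^(2 - alpha) z^alpha. Telescoping the expected descent bounds the
   average, hence the minimum, of E[phi(a)]. *)
Require Import Defs.
From HB Require Import structures.
From mathcomp Require Import all_boot all_order all_algebra.
From mathcomp Require Import all_classical all_reals all_analysis.
From mathcomp Require Import measurable_realfun ring lra.
Import Order.TTheory GRing.Theory Num.Theory.
Import numFieldNormedType.Exports.
Local Open Scope classical_set_scope.
Local Open Scope ring_scope.

(** * Frobenius geometry of real matrices *)

Section Frobenius.
Context {R : realType} {m n : nat}.
Implicit Types A B C G : 'M[R]_(m, n).

Lemma frob_innerE A B : frob_inner A B = \tr (A *m B^T).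
Proof.
rewrite /frob_inner /mxtrace; apply: eq_bigr => i _.
by rewrite mxE; apply: eq_bigr => j _; rewrite mxE.
Qed.

Lemma frob_innerC A B : frob_inner A B = frob_inner B A.
Proof. by do 2![apply: eq_bigr => ? _]; rewrite mulrC. Qed.

Lemma frob_innerDl A B C :
  frob_inner (A + B) C = frob_inner A C + frob_inner B C.
Proof. by rewrite !frob_innerE mulmxDl mxtraceD. Qed.

Lemma frob_innerZl c A B : frob_inner (c *: A) B = c * frob_inner A B.
Proof. by rewrite !frob_innerE -scalemxAl mxtraceZ. Qed.

Lemma frob_innerDr A B C :
  frob_inner C (A + B) = frob_inner C A + frob_inner C B.
Proof. by rewrite !(frob_innerC C) frob_innerDl. Qed.

Lemma frob_innerZr c A B : frob_inner A (c *: B) = c * frob_inner A B.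
Proof. by rewrite !(frob_innerC A) frob_innerZl. Qed.

Lemma frob_innerNl A B : frob_inner (- A) B = - frob_inner A B.
Proof. by rewrite -scaleN1r frob_innerZl mulN1r. Qed.

Lemma frob_innerNr A B : frob_inner A (- B) = - frob_inner A B.
Proof. by rewrite -scaleN1r frob_innerZr mulN1r. Qed.

Lemma frob_inner_ge0 A : 0 <= frob_inner A A.
Proof. by do 2![apply: sumr_ge0 => ? _]; rewrite -expr2 sqr_ge0. Qed.

Lemma frob_norm_ge0 A : 0 <= frob_norm A.
Proof. exact: sqrtr_ge0. Qed.

Lemma sqr_frob_norm A : frob_norm A ^+ 2 = frob_inner A A.
Proof. by rewrite sqr_sqrtr // frob_inner_ge0. Qed.

Lemma ler_entry_frob_norm A i j : `|A i j| <= frob_norm A.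
Proof.
rewrite -sqrtr_sqr ler_wsqrtr // /frob_inner (bigD1 i) //= (bigD1 j) //=.
rewrite expr2 -addrA lerDl addr_ge0 //.
  by apply: sumr_ge0 => ? _; rewrite -expr2 sqr_ge0.
by do 2![apply: sumr_ge0 => ? _]; rewrite -expr2 sqr_ge0.
Qed.

Lemma frob_norm_le_sum A : frob_norm A <= \sum_i \sum_j `|A i j|.
Proof.
have S0 : 0 <= \sum_i \sum_j `|A i j| by do 2![apply: sumr_ge0 => ? _].
rewrite -[leRHS]ger0_norm // -sqrtr_sqr ler_wsqrtr //.
rewrite expr2 mulr_suml ler_sum // => i _.
rewrite mulr_suml ler_sum // => j _.
rewrite -expr2 -real_normK ?num_real // expr2 ler_wpM2l //.
rewrite (bigD1 i) //= (bigD1 j) //= -addrA lerDl addr_ge0 //.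
  by apply: sumr_ge0.
by do 2![apply: sumr_ge0 => ? _].
Qed.

Lemma frob_norm_eq0 A : frob_norm A = 0 -> A = 0.
Proof.
move=> A0; apply/matrixP => i j; rewrite mxE; apply/normr0_eq0/le_anti.
by rewrite normr_ge0 andbT -A0 ler_entry_frob_norm.
Qed.

(** Expand the nonnegative squared norm of [|B| A - |A| B] and cancel the factor [|A| |B|].
    Vanishing norms are treated first because that cancellation needs a positive factor. *)
Lemma frob_CS A B : frob_inner A B <= frob_norm A * frob_norm B.
Proof.
have [A0|A0] := eqVneq (frob_norm A) 0.
  by rewrite A0 (frob_norm_eq0 _ A0) -(scale0r 0) frob_innerZl !mul0r.
have [B0|B0] := eqVneq (frob_norm B) 0.
  by rewrite B0 (frob_norm_eq0 _ B0) -(scale0r 0) frob_innerZr mulr0 mul0r.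
have ab0 : 0 < frob_norm A * frob_norm B.
  by rewrite mulr_gt0 // lt_def ?A0 ?B0 frob_norm_ge0.
have := frob_inner_ge0 (frob_norm B *: A - frob_norm A *: B).
rewrite frob_innerDl !frob_innerDr !frob_innerNl !frob_innerNr.
rewrite !frob_innerZl !frob_innerZr -!sqr_frob_norm (frob_innerC B A) => H.
rewrite -(ler_pM2l ab0); nra.
Qed.

Lemma frob_CS_abs A B : `|frob_inner A B| <= frob_norm A * frob_norm B.
Proof.
rewrite ler_norml frob_CS andbT lerNl -frob_innerNl.
by apply: le_trans (frob_CS _ _) _; rewrite /frob_norm frob_innerNl frob_innerNr opprK.
Qed.

Lemma frob_normN A : frob_norm (- A) = frob_norm A.
Proof. by rewrite /frob_norm frob_innerNl frob_innerNr opprK. Qed.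

Lemma ler_frob_normD A B : frob_norm (A + B) <= frob_norm A + frob_norm B.
Proof.
rewrite -ler_sqr ?nnegrE ?addr_ge0 ?frob_norm_ge0 // sqr_frob_norm.
rewrite frob_innerDl !frob_innerDr (frob_innerC B A) -!sqr_frob_norm.
have := frob_CS A B; nra.
Qed.

Lemma frob_normZ c A : frob_norm (c *: A) = `|c| * frob_norm A.
Proof.
by rewrite /frob_norm frob_innerZl frob_innerZr mulrA -expr2 sqrtrM ?sqr_ge0 // sqrtr_sqr.
Qed.

Lemma frob_norm_delta (c : R) i j :
  frob_norm (c *: (delta_mx i j : 'M[R]_(m, n))) = `|c|.
Proof.
rewrite frob_normZ /frob_norm frob_innerE trmx_delta mul_delta_mx.
rewrite /mxtrace (bigD1 i) //= mxE !eqxx big1 => [|k /negbTE ki].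
  by rewrite addr0 sqrtr1 mulr1.
by rewrite mxE ki.
Qed.

(** Both matrices share the frames [U] and [V], which cancel by cyclicity of the trace. All clipping
    estimates thereby reduce to vectors of singular values. *)
Lemma frob_inner_svd (U : 'M[R]_(m, minn m n)) (V : 'M[R]_(n, minn m n))
    (x y : 'rV[R]_(minn m n)) : U^T *m U = 1%:M -> V^T *m V = 1%:M ->
  frob_inner (U *m diag_mx x *m V^T) (U *m diag_mx y *m V^T) =
  \sum_i x 0 i * y 0 i.
Proof.
move=> UU VV; rewrite frob_innerE !trmx_mul trmxK tr_diag_mx.
rewrite !mulmxA -(mulmxA _ V^T) VV mulmx1 mxtrace_mulC !mulmxA UU mul1mx.
rewrite mulmx_diag mxtrace_diag; apply: eq_bigr => i _.
by rewrite mxE.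
Qed.

(** * Norm and inner-product bounds for spectral clipping *)

Section Clip.
Context (tau : R) (tau0 : 0 < tau) (G C : 'M[R]_(m, n)).
Context (clipGC : spectral_clip tau G C).

(** Termwise this is [min(s, tau)^2 <= s * min(s, tau)]. It controls the second-order term by a
    first-order one. *)
Lemma clip_inner_ge : frob_norm C ^+ 2 <= frob_inner G C.
Proof.
have [U [s [V [[UU VV s0 ->] ->]]]] := clipGC.
rewrite sqr_frob_norm !frob_inner_svd // ler_sum // => i _; rewrite mxE.
by rewrite ler_wpM2r ?ge_min ?lexx // le_min s0 ltW.
Qed.

Lemma clip_norm_le : frob_norm C ^+ 2 <= (minn m n)%:R * tau ^+ 2.
Proof.
have [U [s [V [[UU VV s0 _] ->]]]] := clipGC.
rewrite sqr_frob_norm !frob_inner_svd //.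
have -> : (minn m n)%:R * tau ^+ 2 = \sum_(i < minn m n) tau ^+ 2.
  by rewrite sumr_const card_ord mulr_natl.
rewrite ler_sum // => i _; rewrite mxE -expr2 ler_sqr ?nnegrE ?(ltW tau0) //.
  by rewrite ge_min lexx orbT.
by rewrite le_min s0 ltW.
Qed.

(* Each singular value is at most [|G|_F], so
   [min(s_i, tau) >= s_i * min(1, tau / |G|_F)]. *)
Lemma clip_residual_le : frob_norm (G - C) <= Num.max (frob_norm G - tau) 0.
Proof.
have [U [s [V [[UU VV s0 GE] CE]]]] := clipGC.
have G2 : frob_norm G ^+ 2 = \sum_i s 0 i ^+ 2.
  by rewrite sqr_frob_norm GE frob_inner_svd.
have sG i : s 0 i <= frob_norm G.
  rewrite -ler_sqr ?nnegrE ?frob_norm_ge0 // G2 (bigD1 i) //= lerDl.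
  by apply: sumr_ge0 => ? _; rewrite sqr_ge0.
(* The residual lives in the same frame and has soft-thresholded singular values. *)
have -> : G - C = U *m diag_mx (\row_i Num.max (s 0 i - tau) 0) *m V^T.
  rewrite GE CE -mulmxBl -mulmxBr -raddfB; congr (_ *m diag_mx _ *m _).
  apply/rowP => i; rewrite !mxE minEle maxEle.
  by case: (lerP (s 0 i) tau) => h; case: (lerP (s 0 i - tau) 0) => h' //; lra.
set D := U *m _ *m _.
have [gt|gt] := lerP (frob_norm G) tau.
  rewrite max_r ?subr_le0 // -ler_sqr ?nnegrE ?frob_norm_ge0 //.
  rewrite sqr_frob_norm frob_inner_svd // big1 ?expr0n // => i _.
  by rewrite mxE max_r ?mul0r // subr_le0 (le_trans (sG i)).
have g0 : 0 < frob_norm G by apply: lt_trans gt.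
rewrite max_l ?subr_ge0 ?(ltW gt) //.
rewrite -ler_sqr ?nnegrE ?frob_norm_ge0 ?subr_ge0 ?(ltW gt) //.
have -> : frob_norm G - tau = (1 - tau / frob_norm G) * frob_norm G.
  by field; rewrite gt_eqF.
rewrite sqr_frob_norm frob_inner_svd // exprMn G2 mulr_sumr ler_sum // => i _.
rewrite mxE -expr2 -exprMn ler_sqr ?nnegrE; last 2 first.
- by rewrite le_max lexx orbT.
- by rewrite mulr_ge0 // subr_ge0 ler_pdivrMr // mul1r ltW.
rewrite ge_max; apply/andP; split; last first.
  by rewrite mulr_ge0 // subr_ge0 ler_pdivrMr // mul1r ltW.
rewrite mulrBl mul1r lerB // mulrAC ler_pdivrMr // ler_wpM2l ?(ltW tau0) //.
Qed.

End Clip.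
End Frobenius.

(** * Trading powers of the noise for its moment of order [alpha] *)

Section PowR.
Context {R : realType} (alpha tau z : R).
Context (al1 : 1 < alpha) (al2 : alpha <= 2) (tau0 : 0 < tau) (z0 : 0 <= z).

Lemma sqr_powRE (x : R) : 0 <= x -> x ^+ 2 = x `^ (2 - alpha) * x `^ alpha.
Proof.
by move=> x0; rewrite -powRD subrK ?powR_mulrn // pnatr_eq0.
Qed.

(** Split [z^2] as [z^(2 - alpha) * z^alpha]; since [alpha <= 2], the first factor is monotone in
    [z]. *)
Lemma sqr_le_powR : z <= tau -> z ^+ 2 <= tau `^ (2 - alpha) * z `^ alpha.
Proof.
move=> zt; rewrite sqr_powRE // ler_wpM2r ?powR_ge0 //.
by rewrite ge0_ler_powR ?nnegrE ?subr_ge0 // ltW.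
Qed.

Lemma powR2_le4 : 2 `^ alpha <= 4 :> R.
Proof.
have -> : 4 = 2 `^ 2%:R :> R by rewrite powR_mulrn // -natrX.
by rewrite ler_powR // ler1n.
Qed.

(** Split [tau^2] in the same way and use [tau <= 2 z] in the factor [tau^alpha]; the constant is
    [2^alpha <= 4]. *)
Lemma tau_sqr_le_powR :
  tau / 2 <= z -> tau ^+ 2 <= 4 * tau `^ (2 - alpha) * z `^ alpha.
Proof.
move=> tz; rewrite (sqr_powRE _ (ltW tau0)) (mulrC 4) -mulrA ler_wpM2l ?powR_ge0 //.
have : tau `^ alpha <= (2 * z) `^ alpha.
  have t2z : tau <= 2 * z by lra.
  by rewrite ge0_ler_powR ?nnegrE ?mulr_ge0 ?(ltW tau0) ?(le_trans ler01 (ltW al1)).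
move/le_trans; apply; rewrite powRM // ler_wpM2r ?powR_ge0 //.
exact: powR2_le4.
Qed.

(** Raising [tau <= 2 z] to the power [alpha - 1 <= 1] costs a factor of at most 2; then multiply by
    [z]. *)
Lemma le_powR_tail : tau / 2 <= z -> z <= 2 * tau `^ (1 - alpha) * z `^ alpha.
Proof.
move=> tz; have zp : 0 < z by apply: lt_le_trans tz; rewrite divr_gt0.
have h : tau `^ (alpha - 1) <= 2 * z `^ (alpha - 1).
  have : tau `^ (alpha - 1) <= (2 * z) `^ (alpha - 1).
    have t2z : tau <= 2 * z by lra.
    by rewrite ge0_ler_powR ?nnegrE ?mulr_ge0 ?subr_ge0 ?(ltW tau0) ?(ltW al1).
  move/le_trans; apply; rewrite powRM // ler_wpM2r ?powR_ge0 //.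
  by rewrite -[leRHS](@powRr1 R 2) // ler_powR ?ler1n // lerBlDr.
have -> : 1 - alpha = - (alpha - 1) by ring.
have -> : z `^ alpha = z * z `^ (alpha - 1).
  by rewrite -{2}(@powRr1 R z) // -powRD ?subrKC // (gt_eqF zp) implybT.
rewrite powRN; have tp : 0 < tau `^ (alpha - 1) by rewrite powR_gt0.
have -> : 2 * (tau `^ (alpha - 1))^-1 * (z * z `^ (alpha - 1))
  = z * (2 * z `^ (alpha - 1)) / tau `^ (alpha - 1) by ring.
by rewrite ler_pdivlMr // ler_wpM2l.
Qed.

(* Young's inequality for [z / tau]; in expectation against [E z^alpha <=
   tau^alpha] it recovers the bound [E z <= tau] without loss. *)
Lemma young_powR :
  z <= tau * (1 - alpha^-1) + tau `^ (1 - alpha) / alpha * z `^ alpha.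
Proof.
have alp := lt_trans ltr01 al1.
have iq : 0 < 1 - alpha^-1 by rewrite subr_gt0 invf_lt1.
have := @conjugate_powR R (z / tau) 1 alpha (1 - alpha^-1)^-1
  (divr_ge0 z0 (ltW tau0)) ler01 alp.
rewrite invr_gt0 invrK => /(_ iq); rewrite subrKC => /(_ erefl).
rewrite mulr1 powR1 mul1r ler_pdivrMr //.
move/le_trans; apply; rewrite powRM ?invr_ge0 ?(ltW tau0) //.
have -> : (tau ^-1) `^ alpha = (tau `^ alpha)^-1.
  by rewrite -(powR_inv1 (ltW tau0)) -powRrM mulN1r powRN.
have -> : tau `^ (1 - alpha) = tau / tau `^ alpha.
  by rewrite powRD ?powRr1 ?ltW ?powRN // (gt_eqF tau0) implybT.
have tp : 0 < tau `^ alpha by rewrite powR_gt0.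
by rewrite le_eqVlt; apply/orP; left; apply/eqP; field; rewrite !gt_eqF.
Qed.

End PowR.

(** * Coefficients of the one-step descent bound *)

Section DescentCoefficients.
Context {R : realType} (alpha sigma tau L eta d : R).

Definition second_order_coef : R := 2 * L * eta ^+ 2 * d * tau `^ (2 - alpha).

(* The tail bound [le_powR_tail] gives the first branch of [noise_coef];
   [young_powR] splits [2 eta a z] between the second branches of [noise_coef]
   and [drift]. *)
Definition noise_coef (a : R) : R :=
  (if a <= tau / 2 then 2 * eta * tau `^ (1 - alpha)
   else 2 * eta * (sigma `^ (1 - alpha) / alpha)) * a + second_order_coef.

(** The part of the descent bound determined by the gradient norm alone. In each branch the
    second-order term consumes a quarter of the first-order gain: [a^2] becomes [3/4 a^2], and
    [tau a / 2] becomes [3/8 tau a]. *)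
Definition drift (a : R) : R :=
  if a <= tau / 2 then - (3 / 4 * eta * a ^+ 2)
  else (2 * eta * sigma * (1 - alpha^-1) - 3 / 8 * eta * tau) * a.

(** Times the gradient, this indicator gives a weight with entries bounded by [tau / 2], as
    [Rintegral_weight_eq0] requires. *)
Definition small_grad (a : R) : R := if a <= tau / 2 then 1 else 0.

Lemma measurable_noise_coef : measurable_fun setT noise_coef.
Proof.
apply: measurable_funD => //; apply: measurable_funM => //.
by apply: measurable_fun_ifT => //; exact: measurable_fun_ler.
Qed.

Lemma measurable_drift : measurable_fun setT drift.
Proof.
apply: measurable_fun_ifT; first exact: measurable_fun_ler.
- by apply: measurable_funN; apply: measurable_funM.
- exact: measurable_funM.
Qed.

Lemma measurable_small_grad : measurable_fun setT small_grad.
Proof. by apply: measurable_fun_ifT => //; exact: measurable_fun_ler. Qed.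

Lemma measurable_phi : measurable_fun setT (@phi R).
Proof. exact: measurable_minr. Qed.

(** Nonnegativity allows use as a weight in the conditional moment bound; linear growth in [a] gives
    integrability. *)
Lemma noise_coef_bounds (a : R) : 1 < alpha -> 0 < eta -> 0 < L -> 0 <= d ->
  0 <= a -> 0 <= noise_coef a <=
    (2 * eta * tau `^ (1 - alpha) + 2 * eta * (sigma `^ (1 - alpha) / alpha)) * a
    + second_order_coef.
Proof.
move=> al1 eta0 L0 d0 a0.
have k0 : 0 <= second_order_coef.
  by rewrite mulr_ge0 ?powR_ge0 // mulr_ge0 // mulr_ge0 ?sqr_ge0 // mulr_ge0 ?(ltW L0).
have c1 : 0 <= 2 * eta * tau `^ (1 - alpha).
  by rewrite mulr_ge0 ?powR_ge0 // mulr_ge0 ?(ltW eta0).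
have c2 : 0 <= 2 * eta * (sigma `^ (1 - alpha) / alpha).
  have al0 : 0 <= alpha by lra.
  by rewrite mulr_ge0 ?divr_ge0 ?powR_ge0 // mulr_ge0 ?(ltW eta0).
rewrite /noise_coef lerD2r; set c := if _ then _ else _.
have cb : 0 <= c <= 2 * eta * tau `^ (1 - alpha)
    + 2 * eta * (sigma `^ (1 - alpha) / alpha).
  by rewrite /c; case: ifP => _; apply/andP; split; lra.
have /andP[c0 cle] := cb.
apply/andP; split; first by rewrite addr_ge0 // mulr_ge0.
by rewrite ler_wpM2r.
Qed.

Lemma drift_abs_le (a : R) : 0 < eta -> 0 < tau -> 0 <= a ->
  `|drift a| <= (3 / 8 * eta * tau
    + `|2 * eta * sigma * (1 - alpha^-1) - 3 / 8 * eta * tau|) * a.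
Proof.
move=> eta0 tau0 a0; rewrite /drift [leRHS]mulrDl.
have et : 0 <= 3 / 8 * eta * tau * a by rewrite !mulr_ge0 // ltW.
case: ifP => at2.
  rewrite normrN ger0_norm; last by rewrite mulr_ge0 ?sqr_ge0 // mulr_ge0 // ltW.
  have : eta * a * a <= eta * a * (tau / 2).
    by rewrite ler_wpM2l // mulr_ge0 // ltW.
  have := mulr_ge0 (normr_ge0 (2 * eta * sigma * (1 - alpha^-1) - 3 / 8 * eta * tau)) a0.
  by lra.
by rewrite normrM (ger0_norm a0) lerDr.
Qed.

(** For small [a], with [b = tau^(1 - alpha) sigma^alpha], the bound [2ab <= a^2/2 + 2b^2] leaves
    [-a^2/4]. For large [a], the two Young terms add up to [2 eta sigma a <= eta tau a / 4], which
    leaves [-eta tau a / 8 <= -eta a / 4] because [tau >= 2]. *)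
Lemma drift_bound (a : R) : 0 < sigma -> 0 < eta -> 2 <= tau -> 8 * sigma <= tau -> 0 <= a ->
  noise_coef a * sigma `^ alpha + drift a <=
  - (eta / 4) * phi a + 8 * eta * tau `^ (- (2 * (alpha - 1))) * sigma `^ (2 * alpha)
  + second_order_coef * sigma `^ alpha.
Proof.
move=> sigma0 eta0 t2 ts a0; have tau0 : 0 < tau by apply: lt_le_trans t2.
rewrite /noise_coef /drift /phi.
set b := tau `^ (1 - alpha) * sigma `^ alpha.
have -> : 8 * eta * tau `^ (- (2 * (alpha - 1))) * sigma `^ (2 * alpha) =
    8 * eta * b ^+ 2.
  rewrite /b exprMn -!powR_mulrn ?powR_ge0 // -!powRrM.
  have -> : - (2 * (alpha - 1)) = (1 - alpha) * 2%:R by ring.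
  by rewrite (mulrC alpha) mulrA.
have b0 : 0 <= b by rewrite mulr_ge0 ?powR_ge0.
have [at2|ta] := lerP a (tau / 2).
  have mle : Num.min a (a ^+ 2) <= a ^+ 2 by rewrite ge_min lexx orbT.
  have -> : (2 * eta * tau `^ (1 - alpha) * a + second_order_coef) * sigma `^ alpha
     = 2 * eta * a * b + second_order_coef * sigma `^ alpha by rewrite /b; ring.
  have := sqr_ge0 (a - 2 * b); have := sqr_ge0 b; nra.
have mle : Num.min a (a ^+ 2) <= a by rewrite ge_min lexx.
have -> : (2 * eta * (sigma `^ (1 - alpha) / alpha) * a + second_order_coef) * sigma `^ alpha
   = 2 * eta * a * (sigma / alpha) + second_order_coef * sigma `^ alpha.
  have {3}-> : sigma = sigma `^ (1 - alpha) * sigma `^ alpha.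
    by rewrite -powRD ?subrK ?powRr1 ?ltW // (gt_eqF sigma0) implybT.
  by ring.
have : 0 <= 8 * eta * b ^+ 2.
  by rewrite mulr_ge0 ?sqr_ge0 // mulr_ge0 ?(ltW eta0).
have : 0 <= eta * a * (tau - 8 * sigma) by rewrite !mulr_ge0 ?subr_ge0 ?(ltW eta0).
have : 0 <= eta * a * (tau - 2) by rewrite !mulr_ge0 ?subr_ge0 ?(ltW eta0).
have : eta / 4 * Num.min a (a ^+ 2) <= eta / 4 * a.
  by rewrite ler_wpM2l // divr_ge0 // ltW.
nra.
Qed.

End DescentCoefficients.

(** * Pathwise descent of one clipped step *)

Section Descent.
Context {R : realType} {m n : nat}.
Context (alpha sigma tau L eta : R).
Context (al1 : 1 < alpha) (al2 : alpha <= 2) (sigma0 : 0 < sigma).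
Context (tau0 : 0 < tau) (L0 : 0 < L) (eta0 : 0 < eta).
Context (m0 : (0 < m)%N) (n0 : (0 < n)%N).
Context (eta_le : eta <= 1 / (4 * (minn m n)%:R * L)).

Let d : R := (minn m n)%:R.

Let d1 : 1 <= d.
Proof. by rewrite /d ler1n leq_min m0. Qed.

Lemma step_small : L * eta * d <= 1 / 4.
Proof.
have p : 0 < 4 * d * L by rewrite !mulr_gt0 // (lt_le_trans ltr01).
by move: eta_le; rewrite -/d ler_pdivlMr //; lra.
Qed.

Lemma step_small1 : L * eta <= 1 / 4.
Proof.
apply: le_trans step_small; rewrite ler_peMr // mulr_ge0 ?ltW //.
Qed.

Section Step.
Context (A G C : 'M[R]_(m, n)) (clipGC : spectral_clip tau G C).

Let a := frob_norm A.
Let z := frob_norm (G - A).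
Let g := frob_norm G.
Let c := frob_norm C.
Let a0 : 0 <= a. Proof. exact: frob_norm_ge0. Qed.
Let z0 : 0 <= z. Proof. exact: frob_norm_ge0. Qed.
Let g0 : 0 <= g. Proof. exact: frob_norm_ge0. Qed.
Let c0 : 0 <= c. Proof. exact: frob_norm_ge0. Qed.

Let g_le : g <= a + z.
Proof. by rewrite /g -[X in frob_norm X](subrKC A) ler_frob_normD. Qed.

Let a_le : a <= g + z.
Proof.
by rewrite /a -[X in frob_norm X](subrKC G) (le_trans (ler_frob_normD _ _)) // -opprB frob_normN.
Qed.

Let c_le : c <= g.
Proof.
have := le_trans (clip_inner_ge _ tau0 _ _ clipGC) (frob_CS G C).
rewrite -/c -/g => h; have hg := g0; have [//|gc] := lerP c g; nra.
Qed.

Let noclip : g <= tau -> C = G.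
Proof.
move=> gt; have := clip_residual_le _ tau0 _ _ clipGC.
rewrite -/g max_r ?subr_le0 // => h.
apply/esym/subr0_eq/frob_norm_eq0/le_anti.
by rewrite h frob_norm_ge0.
Qed.

Let noiseZ : 0 <= tau `^ (2 - alpha) * z `^ alpha.
Proof. by rewrite mulr_ge0 ?powR_ge0. Qed.

Let c_sqr_le_big : tau / 2 <= z ->
  c ^+ 2 <= 4 * d * (tau `^ (2 - alpha) * z `^ alpha).
Proof.
move=> tz; have := clip_norm_le _ tau0 _ _ clipGC; rewrite -/d -/c.
move/le_trans; apply.
have := ler_wpM2l (ler0n R (minn m n)) (tau_sqr_le_powR _ _ _ al1 al2 tau0 z0 tz).
by rewrite -/d !mulrA (mulrC 4).
Qed.

Lemma clip_descent_small : a <= tau / 2 ->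
  - eta * frob_inner A C + L / 2 * eta ^+ 2 * c ^+ 2 <=
  - eta * frob_inner A (G - A) + noise_coef alpha sigma tau L eta d a * z `^ alpha + drift alpha sigma tau eta a.
Proof.
have [[t0 l0] e0] := (tau0, L0, eta0); have hd := d1.
have [[[ha hz] hg] hc] := (a0, z0, g0, c0); have [hga hag] := (g_le, a_le).
move=> at2; rewrite /noise_coef /drift at2.
(* If [z < tau / 2] then [g <= tau] and nothing is clipped. Otherwise the residual is at most
   [a + z - tau <= z], to which the tail bound applies. *)
have e_le : frob_norm (G - C) <= 2 * tau `^ (1 - alpha) * z `^ alpha.
  have [tz|zt] := lerP (tau / 2) z.
    apply: le_trans (le_powR_tail _ _ _ al1 al2 tau0 z0 tz).
    apply: le_trans (clip_residual_le _ tau0 _ _ clipGC) _.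
    rewrite ge_max z0 andbT -/g; lra.
  rewrite noclip; last by lra.
  by rewrite subrr /frob_norm -(scale0r 0) frob_innerZl mul0r sqrtr0
    mulr_ge0 ?powR_ge0 // mulr_ge0 ?powR_ge0.
(* For large noise use [c^2 <= d tau^2]; for small noise [C = G], so [c^2 <= 2 a^2 + 2 z^2]. *)
have cc : c ^+ 2 <= 2 * a ^+ 2 + 4 * d * (tau `^ (2 - alpha) * z `^ alpha).
  have [tz|zt] := lerP (tau / 2) z.
    by apply: le_trans (c_sqr_le_big tz) _; rewrite lerDr; nra.
  have -> : c = g by rewrite /c noclip //; lra.
  have zt' : z <= tau by lra.
  have := sqr_le_powR _ _ _ al2 tau0 z0 zt'; have := noiseZ.
  set W := _ * z `^ alpha => W0 zW.
  have g2 : g ^+ 2 <= (a + z) ^+ 2 by rewrite ler_sqr ?nnegrE ?addr_ge0.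
  have := sqr_ge0 (a - z); have : W <= d * W by rewrite ler_peMl.
  nra.
have iC : a ^+ 2 + frob_inner A (G - A) - a * frob_norm (G - C) <= frob_inner A C.
  rewrite sqr_frob_norm -frob_innerDr subrKC lerBlDr -lerBlDl.
  by rewrite -frob_innerNr -frob_innerDr frob_CS.
have ae : a * frob_norm (G - C) <= a * (2 * tau `^ (1 - alpha) * z `^ alpha).
  by rewrite ler_wpM2l.
have h1 : eta * (a ^+ 2 + frob_inner A (G - A) - a * (2 * tau `^ (1 - alpha) * z `^ alpha))
   <= eta * frob_inner A C by rewrite ler_pM2l //; lra.
have h2 : L / 2 * eta ^+ 2 * c ^+ 2 <=
   L / 2 * eta ^+ 2 * (2 * a ^+ 2 + 4 * d * (tau `^ (2 - alpha) * z `^ alpha)).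
  by rewrite ler_wpM2l // mulr_ge0 ?sqr_ge0 // divr_ge0 // ltW.
(* This is the quarter of the gain lost to the second-order term. *)
have h3 : (L * eta) * (eta * a ^+ 2) <= 1 / 4 * (eta * a ^+ 2).
  by rewrite ler_wpM2r ?step_small1 // mulr_ge0 ?sqr_ge0 ?ltW.
by rewrite /second_order_coef -/d; nra.
Qed.

(** Without clipping the inner product is at least [a^2 - a z]. With clipping, [<G, C> >= g tau] and
    [c <= g] give [<A, C> >= g (tau - z)]. The sign of [tau - z] decides whether [g] is replaced by
    its lower bound [a - z] or its upper bound [a + z]; for very large [z], Cauchy-Schwarz on
    [<A, C>] suffices. *)
Lemma clip_inner_big : tau / 2 < a -> tau * a / 2 - 2 * a * z <= frob_inner A C.
Proof.
have [[t0 l0] e0] := (tau0, L0, eta0); have hd := d1.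
have [[[ha hz] hg] hc] := (a0, z0, g0, c0); have [hga hag] := (g_le, a_le).
move=> ta.
have [gt|gt] := lerP g tau.
  rewrite noclip //.
  have -> : frob_inner A G = a ^+ 2 + frob_inner A (G - A).
    by rewrite sqr_frob_norm -frob_innerDr subrKC.
  have := frob_CS_abs A (G - A); rewrite ler_norml -/a -/z => /andP[h _]; nra.
have AC : frob_inner A C = frob_inner G C - frob_inner (G - A) C.
  by rewrite -frob_innerNl -frob_innerDl opprB subrKC.
have GC : g * tau <= frob_inner G C.
  have -> : frob_inner G C = g ^+ 2 - frob_inner G (G - C).
    by rewrite sqr_frob_norm -frob_innerNr -frob_innerDr opprB subrKC.
  have := frob_CS G (G - C); have := clip_residual_le _ tau0 _ _ clipGC.
  rewrite -/g max_l; last by lra.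
  nra.
have NC : frob_inner (G - A) C <= z * g.
  by apply: le_trans (frob_CS _ _) _; rewrite ler_wpM2l.
have ge : g * (tau - z) <= frob_inner A C by rewrite AC; lra.
have [zt|zt] := lerP z tau.
  (* When [z > a > tau / 2] the claimed lower bound is already negative, whereas
     [g (tau - z) >= 0]. *)
  have [za|za] := lerP z a.
    have : (a - z) * (tau - z) <= g * (tau - z).
      by rewrite ler_wpM2r; lra.
    have : 0 <= (a - tau / 2) * (tau / 2 + z) by rewrite mulr_ge0; lra.
    have := sqr_ge0 (z - tau / 4); have := sqr_ge0 tau; nra.
  have : 0 <= g * (tau - z) by rewrite mulr_ge0 //; lra.
  nra.
have [zat|zat] := lerP z (a + tau).
  have : (a + z) * (tau - z) <= g * (tau - z) by rewrite ler_wnM2r //; lra.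
  have : 0 <= z * (a + tau - z) by rewrite mulr_ge0 //; lra.
  nra.
have := frob_CS_abs A C; rewrite ler_norml -/a -/c => /andP[h _].
have : a * c <= a * (a + z) by rewrite ler_wpM2l // (le_trans c_le).
nra.
Qed.

Lemma clip_descent_big : tau / 2 < a ->
  - eta * frob_inner A C + L / 2 * eta ^+ 2 * c ^+ 2 <=
  noise_coef alpha sigma tau L eta d a * z `^ alpha + drift alpha sigma tau eta a.
Proof.
have [[t0 l0] e0] := (tau0, L0, eta0); have hd := d1.
have [[[ha hz] hg] hc] := (a0, z0, g0, c0); have [hga hag] := (g_le, a_le).
move=> ta; rewrite /noise_coef /drift (leNgt a) ta /=.
set q := frob_inner A C.
have qge : tau * a / 2 - 2 * a * z <= q by exact: clip_inner_big.
(* The positive part appears because [q] may be negative under large noise. For small noise,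
   [c^2 <= <G, C> <= q + z c], and [2 z c <= z^2 + c^2] absorbs half of [c^2]. *)
have cc : c ^+ 2 <= 2 * Num.max q 0 + 4 * d * (tau `^ (2 - alpha) * z `^ alpha).
  have [tz|zt] := lerP (tau / 2) z.
    apply: le_trans (c_sqr_le_big tz) _; rewrite lerDr mulr_ge0 //.
    by rewrite le_max lexx orbT.
  have zt' : z <= tau by lra.
  have := sqr_le_powR _ _ _ al2 tau0 z0 zt'.
  have : c ^+ 2 <= q + z * c.
    apply: le_trans (clip_inner_ge _ tau0 _ _ clipGC) _.
    by rewrite -[X in frob_inner X](subrKC A) frob_innerDl lerD2l frob_CS.
  have : q <= Num.max q 0 by rewrite le_max lexx.
  have := sqr_ge0 (z - c); have := noiseZ.
  set W := _ * z `^ alpha => W0 zc qm cq zW.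
  have : W <= d * W by rewrite ler_peMl.
  nra.
(* Young's inequality is taken at scale [sigma], not [tau], to match the moment bound. *)
have yz : 2 * eta * a * z <= 2 * eta * a *
   (sigma * (1 - alpha^-1) + sigma `^ (1 - alpha) / alpha * z `^ alpha).
  rewrite ler_wpM2l //; first by rewrite !mulr_ge0 // ltW.
  exact: young_powR.
have h2 : L / 2 * eta ^+ 2 * c ^+ 2 <=
   L / 2 * eta ^+ 2 * (2 * Num.max q 0 + 4 * d * (tau `^ (2 - alpha) * z `^ alpha)).
  by rewrite ler_wpM2l // mulr_ge0 ?sqr_ge0 // divr_ge0 // ltW.
have h3 : (L * eta) * (eta * Num.max q 0) <= 1 / 4 * (eta * Num.max q 0).
  by rewrite ler_wpM2r ?step_small1 // mulr_ge0 ?le_max ?lexx ?orbT ?ltW.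
have h4 : - eta * q + 1 / 4 * (eta * Num.max q 0) <=
    2 * eta * a * z - 3 / 8 * eta * tau * a.
  have -> : - eta * q + 1 / 4 * (eta * Num.max q 0) = eta * (1 / 4 * Num.max q 0 - q) by ring.
  have -> : 2 * eta * a * z - 3 / 8 * eta * tau * a = eta * (2 * a * z - 3 / 8 * tau * a) by ring.
  rewrite ler_pM2l //; have := mulr_ge0 a0 z0; have := mulr_ge0 (ltW tau0) a0.
  by case: (lerP 0 q) => q0 ? ?; lra.
by rewrite /second_order_coef -/d; nra.
Qed.

Lemma clip_descent :
  - eta * frob_inner A C + L / 2 * eta ^+ 2 * c ^+ 2 <=
  - eta * (small_grad tau a * frob_inner A (G - A))
  + noise_coef alpha sigma tau L eta d a * z `^ alpha + drift alpha sigma tau eta a.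
Proof.
rewrite /small_grad.
have [at2|ta] := lerP a (tau / 2); first by rewrite mul1r clip_descent_small.
by rewrite mul0r mulr0 add0r clip_descent_big.
Qed.

End Step.

End Descent.

(** * From inequalities on events to inequalities with weights *)

Section WeightedIntegral.
Context {d : measure_display} {T : measurableType d} {R : realType}.
Context (mu : {measure set T -> \bar R}) (F : set (set T)).
Context (subF : <<s F >> `<=` measurable).
Context (Z1 Z2 : T -> R).
Context (mZ1 : measurable_fun setT Z1) (mZ2 : measurable_fun setT Z2).
Context (Z1_ge0 : forall w, 0 <= Z1 w) (Z2_ge0 : forall w, 0 <= Z2 w).
Context (leZ : forall A, <<s F >> A ->
  (\int[mu]_(w in A) (Z1 w)%:E <= \int[mu]_(w in A) (Z2 w)%:E)%E).

Lemma sub_measurable_fun (h : T -> R) :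
  measurable_fun setT (h : g_sigma_algebraType F -> R) -> measurable_fun setT h.
Proof. by move=> mh _ B mB; apply: subF; exact: (mh measurableT). Qed.

Import HBNNSimple.

Local Open Scope ereal_scope.

(** Decompose [h] along its finitely many level sets, which belong to the sub-sigma-algebra where
    [leZ] applies. *)
Let integral_nnsfun (h : {nnsfun (g_sigma_algebraType F) >-> R}) (Z : T -> R) :
  measurable_fun setT Z -> (forall w, 0 <= Z w)%R ->
  \int[mu]_w (h w * Z w)%:E =
  \sum_(y \in range h) y%:E * \int[mu]_(w in h @^-1` [set y]) (Z w)%:E.
Proof.
move=> mZ Z0.
have mA y : measurable (h @^-1` [set y] : set T).
  by apply: subF; exact: (measurable_funPTI h (measurable_set1 y)).
have mI y : measurable_fun setT (fun w : T => (\1_(h @^-1` [set y]) w * Z w)%R : R).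
  by apply: measurable_funM => //; exact: measurable_indic.
transitivity (\int[mu]_w
    \sum_(y \in range h) (y * (\1_(h @^-1` [set y]) w * Z w))%:E).
  apply: eq_integral => w _.
  rewrite fsumEFin // [in LHS](fimfunE h w) mulr_fsuml.
  by congr (_%:E); apply: eq_fsbigr => y _; rewrite mulrA.
rewrite ge0_integral_fsum //; last 2 first.
- by move=> y; apply/measurable_EFinP/measurable_funM.
- move=> y w _; rewrite lee_fin indicE.
  have [|_] := boolP (w \in _); last by rewrite mul0r mulr0.
  by rewrite inE /= => <-; rewrite mul1r mulr_ge0.
apply: eq_fsbigr => y; rewrite inE => -[w _ <-].
under eq_integral do rewrite EFinM.
rewrite ge0_integralZl_EFin //; last 2 first.
- by move=> x _; rewrite lee_fin mulr_ge0.
- exact/measurable_EFinP.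
congr (_ * _); rewrite [RHS]integral_mkcond; apply: eq_integral => x _.
by rewrite epatch_indic /= muleC EFinM.
Qed.

(** This extends the eventwise form of a conditional inequality to nonnegative weights: approximate
    [h] from below by simple functions of the sub-sigma-algebra, compare level by level, and pass to
    the limit by monotone convergence. *)
Lemma ge0_le_integral_weight (h : T -> R) :
  measurable_fun setT (h : g_sigma_algebraType F -> R) ->
  (forall w, 0 <= h w)%R ->
  \int[mu]_w (h w * Z1 w)%:E <= \int[mu]_w (h w * Z2 w)%:E.
Proof.
move=> mh h0.
have mEh : measurable_fun setT (EFin \o h : g_sigma_algebraType F -> \bar R).
  exact/measurable_EFinP.
pose a := nnsfun_approx measurableT mEh.
have ma n : measurable_fun setT (a n : T -> R).
  exact: sub_measurable_fun.
have cvgZ (Z : T -> R) : measurable_fun setT Z -> (forall w, 0 <= Z w)%R ->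
    \int[mu]_w (a n w * Z w)%:E @[n --> \oo] --> \int[mu]_w (h w * Z w)%:E.
  move=> mZ Z0.
  have hE w : (h w * Z w)%:E = lim ((a n w * Z w)%:E @[n --> \oo]).
    apply/esym/cvg_lim => //; under eq_fun do rewrite EFinM.
    rewrite EFinM; apply: cvgeZr => //.
    by apply: cvg_nnsfun_approx => // x _; rewrite lee_fin.
  under [X in _ --> X]eq_integral do rewrite hE.
  apply: cvg_monotone_convergence => //.
  - by move=> n; apply/measurable_EFinP/measurable_funM.
  - by move=> n w _; rewrite lee_fin mulr_ge0.
  - move=> w _ p q pq; rewrite lee_fin ler_wpM2r //.
    have /lefP := nd_nnsfun_approx measurableT mEh pq; exact.
apply: (lee_cvg_to (cvgZ _ mZ1 Z1_ge0) (cvgZ _ mZ2 Z2_ge0)).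
apply: nearW => n; rewrite !integral_nnsfun //.
rewrite !fsbig_finite //; apply: lee_sum => y _.
have [y0|y0] := lerP 0%R y.
  by rewrite lee_wpmul2l ?lee_fin // leZ //;
    exact: (measurable_funPTI (a n) (measurable_set1 _)).
(* A nonnegative simple function has an empty level set at a negative value. *)
suff -> : a n @^-1` [set y] = set0 by rewrite !integral_set0.
apply/seteqP; split=> // w /= ay.
have : (0 <= a n w)%R by exact: fun_ge0.
by rewrite ay leNgt y0.
Qed.

End WeightedIntegral.

(** * Measurability of functions of random matrices *)

Section MatrixMeasurability.
Context {d : measure_display} {T : measurableType d} {R : realType} {m n : nat}.

Definition frob_continuous (h : 'M[R]_(m, n) -> R) : Prop :=
  forall Y eps, 0 < eps -> exists2 delta, 0 < delta &
    forall H, frob_norm H < delta -> `|h (Y + H) - h Y| < eps.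

Lemma measurable_frob_norm (X : T -> 'M[R]_(m, n)) :
  (forall i j, measurable_fun setT (fun w => X w i j)) ->
  measurable_fun setT (fun w => frob_norm (X w)).
Proof.
move=> mX.
have -> : (fun w => frob_norm (X w)) =
    Num.sqrt \o (fun w => \sum_i \sum_j X w i j * X w i j) by [].
apply: measurableT_comp.
  exact: continuous_measurable_fun (@sqrt_continuous R).
apply: measurable_sum => i.
by apply: measurable_sum => j; apply: measurable_funM.
Qed.

(* Rounding [X] to the grid of mesh [1 / q.+1] leaves countably many values. *)
Lemma measurable_frob_continuous (h : 'M[R]_(m, n) -> R) (X : T -> 'M[R]_(m, n)) :
  frob_continuous h ->
  (forall i j, measurable_fun setT (fun w => X w i j)) ->
  measurable_fun setT (fun w => h (X w)).
Proof.
move=> hc mX.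
pose I (q : nat) (w : T) : 'M[int]_(m, n) :=
  \matrix_(i, j) Num.floor (X w i j * q.+1%:R).
pose D (q : nat) (M : 'M[int]_(m, n)) : 'M[R]_(m, n) :=
  \matrix_(i, j) ((M i j)%:~R / q.+1%:R).
apply: (@measurable_fun_cvg _ _ _ _ (fun q w => h (D q (I q w)))) => [q|w _].
  move=> _ B mB; rewrite setTI.
  (* Partition by the integer matrix [M] of rounded entries; each cell is a finite intersection of
     preimages of half-open intervals. *)
  have -> : (fun w => h (D q (I q w))) @^-1` B =
      \bigcup_M (if `[< B (h (D q M)) >] then I q @^-1` [set M] else set0).
    apply/seteqP; split=> w /=.
      by move=> Bw; exists (I q w) => //; case: asboolP.
    by move=> [M _]; case: asboolP => //= BM ->.
  apply: countable_bigcupT_measurable => // M; case: ifP => // _.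
  have -> : I q @^-1` [set M] = \bigcap_(ij in [set: 'I_m * 'I_n])
      ((fun w => X w ij.1 ij.2 * q.+1%:R) @^-1`
         `[(M ij.1 ij.2)%:~R, (M ij.1 ij.2 + 1)%:~R[).
    apply/seteqP; split=> w /=.
      by move=> <- [i j] _ /=; rewrite in_itv /= mxE floor_itv.
    move=> H; apply/matrixP => i j; rewrite mxE; apply/eqP.
    by have := H (i, j) Logic.I; rewrite /= in_itv /= => /floor_def ->.
  apply: fin_bigcap_measurable; first exact: finite_finset.
  move=> [i j] _ /=; rewrite -[X in measurable X]setTI.
  by apply: measurable_funM.
apply/cvgrPdist_lt => e e0.
have [delta delta0 hd] := hc (X w) e e0.
near=> q.
have -> : D q (I q w) = X w + (D q (I q w) - X w) by rewrite addrC subrK.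
rewrite distrC; apply: hd.
apply: le_lt_trans (frob_norm_le_sum _) _.
apply: (@le_lt_trans _ _ (\sum_(i < m) \sum_(j < n) q.+1%:R^-1)).
  apply: ler_sum => i _; apply: ler_sum => j _; rewrite !mxE.
  have q0 : 0 < q.+1%:R :> R by [].
  set x := X w i j * _.
  have -> : X w i j = x / q.+1%:R by rewrite mulfK // gt_eqF.
  rewrite -mulrBl normrM.
  rewrite (ger0_norm (x := _^-1)) ?invr_ge0 // ler_piMl ?invr_ge0 //.
  have /andP[x1 x2] := floor_itv x; move: x2; rewrite intrD => x2.
  by rewrite ler_norml; apply/andP; split; lra.
under eq_bigr do rewrite sumr_const card_ord.
rewrite sumr_const card_ord -mulrnA -[_ *+ (n * m)]mulr_natl.
(* The successor keeps the divisor positive even for an empty matrix. *)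
have p : 0 < (n * m).+1%:R :> R by [].
apply: (@le_lt_trans _ _ ((n * m).+1%:R * q.+1%:R^-1)).
  by rewrite ler_wpM2r ?invr_ge0 // ler_nat.
rewrite mulrC -ltr_pdivlMr //; near: q.
have dp : 0 < delta / (n * m).+1%:R by rewrite divr_gt0.
exact: (near_infty_natSinv_lt (PosNum dp)).
Unshelve. all: by end_near.
Qed.
Context (f : 'M[R]_(m, n) -> R) (g : 'M[R]_(m, n) -> 'M[R]_(m, n)).
Context (gradf : is_gradient f g).

(** Differentiability with error parameter 1 gives the local bound
    [|f(Y + K) - f(Y)| <= (|g(Y)| + 1) |K|], which dictates the choice of radius. *)
Lemma is_gradient_continuous : frob_continuous f.
Proof.
move=> Y e e0; have [dl dl0 H] := gradf Y 1 ltr01.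
have c0 : 0 < frob_norm (g Y) + 1 by rewrite ltr_wpDl ?frob_norm_ge0.
exists (Num.min dl (e / (frob_norm (g Y) + 1))).
  by rewrite lt_min dl0 divr_gt0.
move=> K; rewrite lt_min ltr_pdivlMr // => /andP[Kd Ke].
apply: le_lt_trans Ke; have := H K Kd; rewrite mul1r => h.
have -> : f (Y + K) - f Y =
    (f (Y + K) - f Y - frob_inner (g Y) K) + frob_inner (g Y) K by ring.
apply: le_trans (ler_normD _ _) _.
by have := frob_CS_abs (g Y) K; lra.
Qed.

(** Each entry is a pointwise limit of difference quotients of the continuous [f] along
    [delta_mx i j], with steps [1 / q.+1]. *)
Lemma measurable_gradient (X : T -> 'M[R]_(m, n)) i j :
  (forall i j, measurable_fun setT (fun w => X w i j)) ->
  measurable_fun setT (fun w => g (X w) i j).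
Proof.
move=> mX; pose H (q : nat) : 'M[R]_(m, n) := q.+1%:R^-1 *: delta_mx i j.
apply: (@measurable_fun_cvg _ _ _ _
  (fun q w => q.+1%:R * (f (X w + H q) - f (X w)))) => [q|w _].
  apply: measurable_funM => //; apply: measurable_funB.
    apply: (measurable_frob_continuous f (fun w => X w + H q)).
      exact: is_gradient_continuous.
    move=> k l; under eq_fun do rewrite mxE.
    exact: measurable_funD.
  exact: measurable_frob_continuous is_gradient_continuous mX.
apply/cvgrPdist_le => e e0.
have [dl dl0 Hd] := gradf (X w) e e0.
near=> q.
have q0 : 0 < q.+1%:R :> R by [].
have Hq : frob_norm (H q) = q.+1%:R^-1.
  by rewrite frob_norm_delta ger0_norm ?invr_ge0.
have gH : frob_inner (g (X w)) (H q) = q.+1%:R^-1 * g (X w) i j.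
  rewrite frob_innerZr; congr (_ * _); rewrite /frob_inner (bigD1 i) //=.
  rewrite (bigD1 j) //= mxE !eqxx mulr1 !big1 ?addr0 // => [k /negbTE ki|k /negbTE kj].
    by rewrite big1 // => l _; rewrite mxE ki mulr0.
  by rewrite mxE kj andbF mulr0.
have := Hd (H q); rewrite Hq gH => h.
have -> : g (X w) i j - q.+1%:R * (f (X w + H q) - f (X w)) =
   - (q.+1%:R * (f (X w + H q) - f (X w) - q.+1%:R^-1 * g (X w) i j)).
  by field; rewrite gt_eqF.
rewrite normrN normrM gtr0_norm // mulrC -ler_pdivlMr //; apply: h.
by near: q; exact: (near_infty_natSinv_lt (PosNum dl0)).
Unshelve. all: by end_near.
Qed.

End MatrixMeasurability.

(** * Conditional moments tested against measurable weights *)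

Section ConditionalWeights.
Context {d : measure_display} {T : measurableType d} {R : realType}.
Context (P : probability T R) (F : set (set T)).
Context (subF : <<s F >> `<=` measurable).

Lemma integrable_le_norm (h g : T -> R) : measurable_fun setT h ->
  (forall w, `|h w| <= g w) -> P.-integrable setT (EFin \o g) ->
  P.-integrable setT (EFin \o h).
Proof.
move=> mh hg; apply: le_integrable => //; first exact/measurable_EFinP.
by move=> w _; rewrite /= lee_fin (le_trans (hg w)) // ler_norm.
Qed.

Lemma integrable_realD (f g : T -> R) : P.-integrable setT (EFin \o f) ->
  P.-integrable setT (EFin \o g) ->
  P.-integrable setT (EFin \o (fun w => f w + g w)).
Proof. by move=> fi gi; have := integrableD measurableT fi gi. Qed.

Lemma integrable_realZ c (f : T -> R) : P.-integrable setT (EFin \o f) ->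
  P.-integrable setT (EFin \o (fun w => c * f w)).
Proof. by move=> fi; have := integrableZl measurableT c fi. Qed.

Lemma integrable_bounded_mul (h Y : T -> R) (M : R) :
  measurable_fun setT h -> (forall w, `|h w| <= M) ->
  P.-integrable setT (EFin \o Y) ->
  P.-integrable setT (EFin \o (fun w => h w * Y w)).
Proof.
move=> mh hM iY; apply: (@integrable_le_norm _ (fun w => M * `|Y w|)).
- by apply: measurable_funM => //; exact/measurable_EFinP/(measurable_int P).
- by move=> w; rewrite normrM ler_wpM2r.
- by apply: integrable_realZ; exact: integrable_norm.
Qed.

(** Apply [ge0_le_integral_weight] against the constant [c]. The finite right-hand side also yields
    integrability of the product. *)
Lemma Rintegral_weight_le (h Z : T -> R) (c : R) :
  0 <= c ->
  measurable_fun setT (h : g_sigma_algebraType F -> R) ->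
  (forall w, 0 <= h w) -> P.-integrable setT (EFin \o h) ->
  measurable_fun setT Z -> (forall w, 0 <= Z w) ->
  (forall A, <<s F >> A -> (\int[P]_(w in A) (Z w)%:E <= c%:E * P A)%E) ->
  P.-integrable setT (EFin \o (fun w => h w * Z w)) /\
  \int[P]_w (h w * Z w) <= c * \int[P]_w h w.
Proof.
move=> c0 mh h0 ih mZ Z0 leZ.
have le_int : (\int[P]_w (h w * Z w)%:E <= \int[P]_w (h w * c)%:E)%E.
  apply: (ge0_le_integral_weight P F subF _ (cst c)) => //= A FA.
  by rewrite integral_cst ?leZ //; exact: subF.
have ihc : P.-integrable setT (EFin \o (fun w => h w * c)).
  rewrite (_ : (fun w => h w * c) = (fun w => c * h w)); first exact: integrable_realZ.
  by apply/funext => w; rewrite mulrC.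
have ihZ : P.-integrable setT (EFin \o (fun w => h w * Z w)).
  apply/integrableP; split.
    by apply/measurable_EFinP/measurable_funM => //; exact: sub_measurable_fun subF _ mh.
  under eq_integral do rewrite /= ger0_norm ?mulr_ge0 //.
  exact: le_lt_trans le_int (integrable_lty measurableT ihc).
split=> //; rewrite -RintegralZl //.
under [leRHS]eq_Rintegral do rewrite mulrC.
by rewrite /Rintegral fine_le ?integrable_fin_num.
Qed.

(** Adding [M] makes the weight nonnegative without changing the integral, as [Y] has mean zero. A
    one-sided bound applied to [Y] and [- Y] then gives equality. *)
Lemma Rintegral_weight_eq0 (h Y : T -> R) (M : R) :
  measurable_fun setT (h : g_sigma_algebraType F -> R) ->
  (forall w, `|h w| <= M) -> P.-integrable setT (EFin \o Y) ->
  (forall A, <<s F >> A -> (\int[P]_(w in A) (Y w)%:E = 0)%E) ->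
  P.-integrable setT (EFin \o (fun w => h w * Y w)) /\
  \int[P]_w (h w * Y w) = 0.
Proof.
move=> mhF hM iY Y0.
have mh := sub_measurable_fun F subF h mhF.
have M0 w : 0 <= h w + M by have := hM w; rewrite ler_norml => /andP[]; lra.
have ihY : P.-integrable setT (EFin \o (fun w => h w * Y w)) by exact: integrable_bounded_mul hM iY.
have half (Y' : T -> R) : P.-integrable setT (EFin \o Y') ->
    (forall A, <<s F >> A -> (\int[P]_(w in A) (Y' w)%:E = 0)%E) ->
    \int[P]_w ((h w + M) * Y' w) <= 0.
  move=> iY' Y'0.
  have mY' : measurable_fun setT Y' by exact/measurable_EFinP/(measurable_int P).
  have iN : P.-integrable setT (EFin \o (fun w => `|Y' w|)) by exact: integrable_norm.
  have mhM : measurable_fun setT ((fun w => h w + M) : g_sigma_algebraType F -> R).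
    exact: measurable_funD.
  have hMM w : `|h w + M| <= M + M.
    rewrite ger0_norm // lerD2r; exact: le_trans (ler_norm _) (hM w).
  have ihN : P.-integrable setT (EFin \o (fun w => (h w + M) * `|Y' w|)).
    by apply: integrable_bounded_mul hMM iN; exact: measurable_funD.
  have ihY' : P.-integrable setT (EFin \o (fun w => (h w + M) * Y' w)).
    by apply: integrable_bounded_mul hMM iY'; exact: measurable_funD.
  (* The signed [Y'] is shifted by its absolute value: both integrands become nonnegative and have
     equal integrals over every event of the sub-sigma-algebra. *)
  have : (\int[P]_w ((h w + M) * (`|Y' w| + Y' w))%:E <=
          \int[P]_w ((h w + M) * `|Y' w|)%:E)%E.
    apply: (ge0_le_integral_weight P F subF) => //.
    - by apply: measurable_funD => //; exact: measurableT_comp.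
    - exact: measurableT_comp.
    - by move=> w; have := ler_norm (- Y' w); rewrite normrN; lra.
    - move=> A FA; have mA := subF _ FA.
      rewrite -[leLHS]/(\int[P]_(w in A) ((`|Y' w|)%:E + (Y' w)%:E))%E.
      rewrite integralD //; last 2 first.
      + exact: integrableS iN.
      + exact: integrableS iY'.
      by rewrite Y'0 // adde0.
  under eq_integral do rewrite mulrDr.
  move=> le1.
  have := fine_le (integrable_fin_num measurableT (integrable_realD _ _ ihN ihY'))
    (integrable_fin_num measurableT ihN) le1.
  rewrite -/(Rintegral P setT (fun w => (h w + M) * `|Y' w| + (h w + M) * Y' w)).
  rewrite -/(Rintegral P setT (fun w => (h w + M) * `|Y' w|)).
  by rewrite RintegralD // gerDl.
have iMY : P.-integrable setT (EFin \o (fun w => M * Y w)).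
  exact: integrable_realZ.
have split_int : \int[P]_w ((h w + M) * Y w) = \int[P]_w (h w * Y w).
  under eq_Rintegral do rewrite mulrDl.
  rewrite RintegralD // RintegralZl //.
  by rewrite [X in M * X](_ : _ = 0) ?mulr0 ?addr0 // /Rintegral Y0 //;
    exact: (@measurableT _ (g_sigma_algebraType F)).
split=> //; apply/le_anti; rewrite -split_int half //=.
rewrite -oppr_le0 -[leLHS]mulN1r -RintegralZl //; last first.
  apply: (@integrable_bounded_mul _ _ (M + M)) => //; first exact: measurable_funD.
  by move=> w; rewrite ger0_norm // lerD2r; exact: le_trans (ler_norm _) (hM w).
under eq_Rintegral do rewrite mulrCA.
apply: (half (fun w => -1 * Y w)); first exact: integrable_realZ.
move=> A FA; have mA := subF _ FA.
rewrite -[LHS]/(\int[P]_(w in A) ((-1)%:E * (Y w)%:E))%E.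
by rewrite integralZl ?Y0 ?mule0 //; exact: integrableS iY.
Qed.

End ConditionalWeights.

(** * Finite sums of integrable functions *)

Section RealSums.
Context {d : measure_display} {T : measurableType d} {R : realType}.
Context (P : probability T R) (I : Type) (h : I -> T -> R).
Context (ih : forall i, P.-integrable setT (EFin \o h i)).

Lemma integrable_real_sum (s : seq I) :
  P.-integrable setT (EFin \o (fun w => \sum_(i <- s) h i w)).
Proof.
elim: s => [|i s IH].
  by under eq_fun do rewrite big_nil; exact: finite_measure_integrable_cst.
under eq_fun do rewrite big_cons.
exact: integrable_realD.
Qed.

Lemma Rintegral_sum (s : seq I) :
  \int[P]_w (\sum_(i <- s) h i w) = \sum_(i <- s) \int[P]_w h i w.
Proof.
elim: s => [|i s IH].
  by under eq_Rintegral do rewrite big_nil; rewrite big_nil Rintegral_cst // mul0r.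
under eq_Rintegral do rewrite big_cons.
by rewrite big_cons RintegralD // ?IH //; exact: integrable_real_sum.
Qed.

End RealSums.

(** * Expected descent of one step *)

Lemma integrable_frob_norm (d : measure_display) (T : measurableType d)
    (R : realType) (P : probability T R) (m n : nat) (A : T -> 'M[R]_(m, n)) :
  (forall i j, P.-integrable setT (fun w => (A w i j)%:E)) ->
  P.-integrable setT (EFin \o (fun w => frob_norm (A w))).
Proof.
move=> iA; apply: (@integrable_le_norm _ _ _ P _
  (fun w => \sum_i \sum_j `|A w i j|)).
- apply: measurable_frob_norm => i j.
  exact/measurable_EFinP/(measurable_int P (iA i j)).
- by move=> w; rewrite ger0_norm ?frob_norm_ge0 // frob_norm_le_sum.
- apply: integrable_real_sum => i; apply: integrable_real_sum => j.
  by apply: integrable_norm; exact: iA.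
Qed.

Lemma sigma_rv_measurable (d : measure_display) (T : measurableType d)
    (R : realType) (m n : nat) (X : T -> 'M[R]_(m, n)) :
  (forall i j, measurable_fun setT (fun w => X w i j)) ->
  sigma_rv X `<=` measurable.
Proof.
move=> mX; apply: smallest_sub; first exact: sigma_algebra_measurable.
move=> _ [i [j [B [mB ->]]]]; rewrite -[X in measurable X]setTI.
exact: mX.
Qed.

Lemma measurable_sigma_rv (d : measure_display) (T : measurableType d)
    (R : realType) (m n : nat) (X : T -> 'M[R]_(m, n)) i j :
  measurable_fun setT
    ((fun w => X w i j) : g_sigma_algebraType (gen_events X) -> R).
Proof.
by move=> _ B mB; rewrite setTI; apply: sub_sigma_algebra; exists i, j, B.
Qed.

(** Integrates [clip_descent], with weights depending on [X] alone. Integrability of [f (X' w)] is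
    part of the conclusion so that the step can be iterated. *)
Lemma clipped_step (R : realType) (m n : nat) (disp : measure_display)
    (T : measurableType disp) (f : 'M[R]_(m, n) -> R) (gradf : 'M[R]_(m, n) -> 'M[R]_(m, n))
    (L : R) (P : probability T R) (X X' G : T -> 'M[R]_(m, n))
    (alpha sigma eta tau c : R) :
  (0 < m)%N -> (0 < n)%N -> 0 < L ->
  is_gradient f gradf -> L_smooth L f gradf -> (forall Y, c <= f Y) ->
  1 < alpha -> alpha <= 2 -> 0 < sigma ->
  0 < eta -> eta <= 1 / (4 * (minn m n)%:R * L) ->
  2 <= tau -> 8 * sigma <= tau ->
  (forall i j, measurable_fun setT (fun w => X w i j)) ->
  (forall i j, measurable_fun setT (fun w => X' w i j)) ->
  (forall w, exists C, spectral_clip tau (G w) C /\ X' w = X w - eta *: C) ->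
  (forall i j, P.-integrable setT (fun w => (G w i j)%:E)) ->
  (forall i j, P.-integrable setT (fun w => (gradf (X w) i j)%:E)) ->
  (forall A, sigma_rv X A -> forall i j,
     (\int[P]_(w in A) (G w i j)%:E =
      \int[P]_(w in A) (gradf (X w) i j)%:E)%E) ->
  (forall A, sigma_rv X A ->
     (\int[P]_(w in A) ((frob_norm (G w - gradf (X w))) `^ alpha)%:E
        <= (sigma `^ alpha)%:E * P A)%E) ->
  P.-integrable setT (EFin \o (fun w => f (X w))) ->
  [/\ P.-integrable setT (EFin \o (fun w => f (X' w))),
      P.-integrable setT (EFin \o (fun w => phi (frob_norm (gradf (X w))))) &
      \int[P]_w f (X' w) <= \int[P]_w f (X w)
        - eta / 4 * \int[P]_w phi (frob_norm (gradf (X w)))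
        + (8 * eta * tau `^ (- (2 * (alpha - 1))) * sigma `^ (2 * alpha)
           + 2 * L * eta ^+ 2 * (minn m n)%:R * tau `^ (2 - alpha) * sigma `^ alpha)].
Proof.
move=> m0 n0 L0 gradP smooth fc al1 al2 s0 eta0 eta_le t2 ts mX mX' clip iG iA
  condE condM ifX.
have tau0 : 0 < tau by lra.
set d : R := (minn m n)%:R.
have d0 : 0 <= d by [].
pose A w := gradf (X w); pose a w := frob_norm (A w).
pose N w := G w - A w; pose Z w := frob_norm (N w) `^ alpha.
have a0 w : 0 <= a w by exact: frob_norm_ge0.
have subF := sigma_rv_measurable _ _ _ _ _ X mX.
pose T' : measurableType _ := g_sigma_algebraType (gen_events X).
(* Running the measurability lemma on the space with sigma-algebra generated by [X] makes the
   gradient an admissible weight. *)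
have mFA i j : measurable_fun setT ((fun w => A w i j) : T' -> R).
  apply: (@measurable_gradient _ T' _ _ _ _ _ gradP X) => k l.
  exact: measurable_sigma_rv.
have mFa : measurable_fun setT (a : T' -> R).
  exact: (@measurable_frob_norm _ T').
have sub (h : T -> R) : measurable_fun setT (h : T' -> R) -> measurable_fun setT h.
  exact: sub_measurable_fun.
have ma := sub _ mFa.
have ia : P.-integrable setT (EFin \o a) by exact: integrable_frob_norm.
have iN i j : P.-integrable setT (EFin \o (fun w => N w i j)).
  have -> : (fun w => N w i j) = (fun w => G w i j + -1 * A w i j).
    by apply/funext => w; rewrite !mxE mulN1r.
  by apply: integrable_realD; [exact: iG|apply: integrable_realZ; exact: iA].
have N0 i j B : sigma_rv X B -> (\int[P]_(w in B) (N w i j)%:E = 0)%E.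
  move=> FB; have mB := subF _ FB.
  under eq_integral do rewrite !mxE EFinB.
  rewrite integralB //; last 2 first.
  - exact: integrableS (iG i j).
  - exact: integrableS (iA i j).
  rewrite condE // subee //; apply: integrable_fin_num => //.
  exact: integrableS (iA i j).
have mZ : measurable_fun setT Z.
  have -> : Z = (@powR R ^~ alpha) \o (fun w => frob_norm (N w)) by [].
  apply: measurableT_comp; first exact: measurable_powR.
  apply: measurable_frob_norm => i j.
  exact/measurable_EFinP/(measurable_int P (iN i j)).
pose b w := small_grad tau (a w).
have mFb : measurable_fun setT (b : T' -> R).
  exact: (measurableT_comp (measurable_small_grad tau)).
(* The cross term vanishes entry by entry, the truncated gradient entry being the bounded weight. *)
have bA i j : P.-integrable setT (EFin \o (fun w => b w * A w i j * N w i j)) /\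
    \int[P]_w (b w * A w i j * N w i j) = 0.
  apply: (Rintegral_weight_eq0 P (gen_events X) subF _ _ (tau / 2)) => //.
  - exact: measurable_funM.
  - move=> w; rewrite /b /small_grad normrM; case: ifP => at2.
      by rewrite normr1 mul1r (le_trans (ler_entry_frob_norm _ _ _)).
    by rewrite normr0 mul0r divr_ge0 // ltW.
  - by move=> B FB; exact: N0.
pose V w := \sum_i \sum_j b w * A w i j * N w i j.
have VE w : V w = b w * frob_inner (A w) (N w).
  rewrite mulr_sumr; apply: eq_bigr => i _; rewrite mulr_sumr.
  by apply: eq_bigr => j _; rewrite mulrA.
have iV : P.-integrable setT (EFin \o V).
  by apply: integrable_real_sum => i; apply: integrable_real_sum => j; exact: (bA i j).1.
have V0 : \int[P]_w V w = 0.
  rewrite Rintegral_sum; last first.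
    by move=> i; apply: integrable_real_sum => j; exact: (bA i j).1.
  rewrite big1 // => i _; rewrite Rintegral_sum; last by move=> j; exact: (bA i j).1.
  by rewrite big1 // => j _; rewrite (bA i j).2.
pose k w := noise_coef alpha sigma tau L eta d (a w).
have mFk : measurable_fun setT (k : T' -> R).
  exact: (measurableT_comp (measurable_noise_coef alpha sigma tau L eta d)).
have k_bnd w := noise_coef_bounds alpha sigma tau L eta d (a w) al1 eta0 L0 d0 (a0 w).
have icst (x : R) : P.-integrable setT (EFin \o (fun=> x)).
  exact: finite_measure_integrable_cst.
have ik : P.-integrable setT (EFin \o k).
  apply: (integrable_le_norm _ _ (fun w => _ * a w + _)).
  - exact: sub.
  - by move=> w; have /andP[h1 h2] := k_bnd w; rewrite ger0_norm //; exact: h2.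
  - by apply: integrable_realD => //; exact: integrable_realZ.
have [ikZ kZ] := Rintegral_weight_le P (gen_events X) subF k Z (sigma `^ alpha)
  (powR_ge0 _ _) mFk (fun w => (andP (k_bnd w)).1) ik mZ (fun w => powR_ge0 _ _) condM.
pose r w := drift alpha sigma tau eta (a w).
have ir : P.-integrable setT (EFin \o r).
  apply: (integrable_le_norm _ _ (fun w => _ * a w)).
  - exact: (measurableT_comp (measurable_drift alpha sigma tau eta)).
  - by move=> w; exact: drift_abs_le.
  - exact: integrable_realZ.
have iphi : P.-integrable setT (EFin \o (fun w => phi (a w))).
  apply: (integrable_le_norm _ _ a) => //.
  - exact: (measurableT_comp measurable_phi).
  - move=> w; rewrite ger0_norm; last by rewrite le_min a0 sqr_ge0.
    by rewrite ge_min lexx.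
pose U w := f (X w) + (- eta * V w + (k w * Z w + r w)).
have iU : P.-integrable setT (EFin \o U).
  apply: integrable_realD => //; apply: integrable_realD.
    exact: integrable_realZ.
  exact: integrable_realD.
have fU w : f (X' w) <= U w.
  have [C [clipC ->]] := clip w.
  have := smooth (X w - eta *: C) (X w).
  have -> : X w - eta *: C - X w = - (eta *: C) by rewrite addrAC subrr add0r.
  rewrite frob_normN frob_normZ frob_innerNr frob_innerZr (gtr0_norm eta0) exprMn.
  have := clip_descent alpha sigma tau L eta al1 al2 s0 tau0 L0 eta0 m0 n0 eta_le
    (A w) (G w) C clipC.
  rewrite -/d -/(a w) -/(N w) -/(b w) -/(Z w) -/(k w) -/(r w) -VE /U -/(A w).
  lra.
(* [f (X' w)] lies between the constant [c] and the integrable [U w]. *)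
have if' : P.-integrable setT (EFin \o (fun w => f (X' w))).
  apply: (integrable_le_norm _ _ (fun w => `|U w| + `|c|)).
  - exact: measurable_frob_continuous (is_gradient_continuous _ _ gradP) mX'.
  - move=> w; have := fU w; have := fc (X' w).
    have := ler_norm (U w); have := ler_norm (- c); rewrite normrN.
    have := normr_ge0 (U w); have := normr_ge0 c.
    by rewrite ler_norml => ? ? ? ? ? ?; apply/andP; split; lra.
  - by apply: integrable_realD => //; exact: integrable_norm.
split=> //; apply: (@le_trans _ _ (\int[P]_w U w)).
  by apply: le_Rintegral.
rewrite /U RintegralD //; last first.
  by apply: integrable_realD; [exact: integrable_realZ|exact: integrable_realD].
rewrite RintegralD //; [|exact: integrable_realZ|exact: integrable_realD].
rewrite RintegralZl // V0 mulr0 add0r RintegralD //.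
set B := _ + _ * sigma `^ alpha.
have : \int[P]_w (k w * sigma `^ alpha + r w) <=
    \int[P]_w (- (eta / 4) * phi (a w) + B).
  apply: le_Rintegral => //.
  - apply: integrable_realD => //.
    rewrite (_ : (fun w => _) = (fun w => sigma `^ alpha * k w)); first exact: integrable_realZ.
    by apply/funext => w; rewrite mulrC.
  - by apply: integrable_realD => //; exact: integrable_realZ.
  - move=> w _; have := drift_bound alpha sigma tau L eta d (a w) s0 eta0 t2 ts (a0 w).
    by rewrite /B /second_order_coef addrA.
under eq_Rintegral do rewrite mulrC.
rewrite RintegralD //; last exact: integrable_realZ.
rewrite RintegralD //; last exact: integrable_realZ.
rewrite RintegralZl // RintegralZl // Rintegral_cst //.
have -> : fine (P [set: T]) = 1 by rewrite (@probability_setT _ _ _ P).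
by rewrite mulr1 -/(a _) => h; move: kZ h; lra.
Qed.

(** * Telescoping and the final bound *)

Theorem theorem2 (R : realType) (m n : nat)
  (f : 'M[R]_(m, n) -> R) (gradf : 'M[R]_(m, n) -> 'M[R]_(m, n)) (L : R)
  (d0 : measure_display) (Omega : measurableType d0)
  (P : probability Omega R)
  (X G : nat -> Omega -> 'M[R]_(m, n)) (X0 : 'M[R]_(m, n))
  (alpha sigma eta tau : R) (K : nat) :
  (0 < m)%N -> (0 < n)%N -> 0 < L ->
  is_gradient f gradf ->
  L_smooth L f gradf ->
  (exists c : R, forall Y, c <= f Y) ->
  1 < alpha -> alpha <= 2 -> 0 < sigma ->
  0 < eta -> eta <= 1 / (4 * (minn m n)%:R * L) ->
  Num.max 2 (8 * sigma) <= tau ->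
  (* deterministic initial point *)
  (forall w, X 0%N w = X0) ->
  (* the iterates are random variables *)
  (forall k i j, measurable_fun setT (fun w => X k w i j)) ->
  (* the iteration X_{k+1} = X_k - eta * C_tau(G_k) *)
  (forall k w, exists C, spectral_clip tau (G k w) C /\
                         X k.+1 w = X k w - eta *: C) ->
  (* E[G_k | X_k] = grad f(X_k) *)
  (forall k i j, P.-integrable setT (fun w => (G k w i j)%:E)) ->
  (forall k i j, P.-integrable setT (fun w => (gradf (X k w) i j)%:E)) ->
  (forall k A, sigma_rv (X k) A -> forall i j,
     (\int[P]_(w in A) (G k w i j)%:E =
      \int[P]_(w in A) (gradf (X k w) i j)%:E)%E) ->
  (* E[ ||G_k - grad f(X_k)||_F^alpha | X_k ] <= sigma^alpha *)
  (forall k A, sigma_rv (X k) A ->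
     (\int[P]_(w in A) ((frob_norm (G k w - gradf (X k w))) `^ alpha)%:E
        <= (sigma `^ alpha)%:E * P A)%E) ->
  (0 < K)%N ->
  (\big[Order.min/+oo%E]_(k < K)
      \int[P]_w (phi (frob_norm (gradf (X k w))))%:E
   <= (4 * (f X0 - inf (range f)) / (eta * K%:R)
       + 32 * tau `^ (- (2 * (alpha - 1))) * sigma `^ (2 * alpha)
       + 8 * eta * (minn m n)%:R * L * tau `^ (2 - alpha) * sigma `^ alpha)%:E)%E.

Proof.
move=> m0 n0 L0 gradP smooth [c fc] al1 al2 s0 eta0 eta_le tau_ge X00 mX clip iG iA
  condE condM K0.
move: tau_ge; rewrite ge_max => /andP[t2 ts].
pose p k := \int[P]_w phi (frob_norm (gradf (X k w))).
pose e k := \int[P]_w f (X k w).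
set B1 := 32 * tau `^ _ * _; set B2 := 8 * eta * _ * L * _ * _.
have step k := clipped_step _ _ _ _ _ f gradf L P (X k) (X k.+1) (G k) alpha sigma eta tau c
  m0 n0 L0 gradP smooth fc al1 al2 s0 eta0 eta_le t2 ts (mX k) (mX k.+1)
  (clip k) (iG k) (iA k) (condE k) (condM k).
have ifX k : P.-integrable setT (EFin \o (fun w => f (X k w))).
  elim: k => [|k /step[]//].
  under eq_fun do rewrite /= X00.
  exact: finite_measure_integrable_cst.
have iphi k : P.-integrable setT (EFin \o (fun w => phi (frob_norm (gradf (X k w))))).
  by have [] := step k (ifX k).
(* Factoring out [eta / 4] turns the errors [8 eta] and [2 L eta^2 d] into the constants 32 and
   [8 eta d L] of the claim. *)
have estep k : e k.+1 <= e k - eta / 4 * p k + eta / 4 * (B1 + B2).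
  have [_ _ h] := step k (ifX k); apply: le_trans h _.
  by rewrite lerD2l le_eqVlt; apply/orP; left; apply/eqP; rewrite /B1 /B2; field.
have esum j : e j + eta / 4 * \sum_(k < j) p k <= f X0 + j%:R * (eta / 4 * (B1 + B2)).
  elim: j => [|j IH].
    rewrite big_ord0 mulr0 mul0r !addr0 /e.
    under eq_Rintegral do rewrite X00.
    have P1 : fine (P [set: Omega]) = 1 by rewrite (@probability_setT _ _ _ P).
    by rewrite Rintegral_cst // P1 mulr1.
  have := estep j; move: IH; rewrite big_ord_recr /= -(natr1 j); lra.
have inf_le : inf (range f) <= e K.
  have P1 : fine (P [set: Omega]) = 1 by rewrite (@probability_setT _ _ _ P).
  have -> : inf (range f) = \int[P]_(w in setT) (cst (inf (range f)) w).
    by rewrite Rintegral_cst // P1 mulr1.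
  apply: le_Rintegral => //; first exact: finite_measure_integrable_cst.
  move=> w _ /=; apply: ge_inf; last by exists (X K w).
  by exists c => _ [Y _ <-].
set bound := (X in (_ <= X%:E)%E).
have KR : 0 < K%:R :> R by rewrite ltr0n.
have sum_le : \sum_(k < K) p k <= K%:R * bound.
  have e4 : 0 < eta / 4 by rewrite divr_gt0.
  have bE : eta / 4 * (K%:R * bound) =
      f X0 - inf (range f) + K%:R * (eta / 4 * (B1 + B2)).
    by rewrite /bound; field; rewrite !gt_eqF.
  by rewrite -(ler_pM2l e4) bE; have := esum K; lra.
(* If every term exceeded [bound], so would the average; [K > 0] makes the summed inequality
   strict. *)
have [k kb] : exists k : 'I_K, p k <= bound.
  apply/not_existsP => no.
  have : \sum_(k < K) bound < \sum_(k < K) p k.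
    apply: ltr_sum; last by move=> i _; rewrite ltNge; apply/negP/no.
    by apply/hasP; exists (Ordinal K0); rewrite ?mem_index_enum.
  by rewrite sumr_const card_ord -mulr_natl ltNge sum_le.
apply: (@le_trans _ _ (\int[P]_w (phi (frob_norm (gradf (X k w))))%:E)%E).
  exact: bigmin_le.
(* Integrability identifies the extended-real integral with the real number [p k]. *)
by rewrite -(fineK (integrable_fin_num measurableT (iphi k))) lee_fin.
Qed.
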